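(* Fix a geometry with forward map $M$ and let the observed profile be perturbed by $\delta k$. The simplex-restricted recovery error $\delta w$ satisfies, to first order and away from simplex-boundary clipping, $$\|\delta w\|=\left\|B(MB)^+\delta k\right\|\le\frac{\|\delta k\|}{\sigma_{\min}(MB)},$$ and this bound is attained when $\delta k$ aligns with the least left singular vector of $MB$ (the one associated with $\sigma_{\min}(MB)$). Equivalently, using the identities $\sigma_{\min}(MB)\,\sigma_{\max}(MB)=\mathcal{A}(g)/\sqrt3$ and $\kappa_s=\sqrt3\,\sigma_{\max}(MB)^2/\mathcal{A}(g)$, $$\|\delta w\|\ \lesssim\ \frac{\|\delta k\|}{\sigma_{\min}(MB)}=\frac{\sqrt3\,\sigma_{\max}(MB)}{\mathcal{A}(g)}\,\|\delta k\|=\frac{\kappa_s}{\sigma_{\max}(MB)}\,\|\delta k\| .$$ Hence the recovery error scales with $\kappa_s$ only at fixed $\sigma_{\max}(MB)$. When $\sigma_{\max}$ varies across geometries, $\kappa_s$ alone does not determine the error; the intrinsic stability margin is $\sigma_{\min}(MB)$.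
   Context: For a geometry $g$, $K_T,K_B,K_P$ are three real-valued functions (profiles) on the half crack-front $[0,\pi/2]$, sampled at points $\varphi_1,\dots,\varphi_N$; $M\in\mathbb{R}^{N\times3}$ is the matrix whose $i$-th row is $(K_T(\varphi_i),K_B(\varphi_i),K_P(\varphi_i))$. A load is a vector $w=(\alpha,\beta,\gamma)$ in the simplex $\Delta^2=\{w\in\mathbb{R}^3:w_i\ge0,\ w_1+w_2+w_3=1\}$, and its sampled profile is $k=Mw$. The load is recovered from an observed profile $k_{\mathrm{obs}}\in\mathbb{R}^N$ by simplex-constrained least squares, minimizing $\|Mw-k_{\mathrm{obs}}\|^2$ over $w\in\Delta^2$; $\delta w$ is the resulting change in the recovered load when the profile is perturbed by $\delta k\in\mathbb{R}^N$. Away from simplex-boundary clipping (the nonnegativity constraints not being active), this is taken on the sum-zero tangent: $\delta w=Bu^\star$ with $u^\star$ the minimum-norm minimizer of $\|MBu-\delta k\|$ over $u\in\mathbb{R}^2$. Norms on vectors are Euclidean. $B\in\mathbb{R}^{3\times2}$ is a matrix whose columns form an orthonormal basis of $\{v\in\mathbb{R}^3:v_1+v_2+v_3=0\}$; $(MB)^+$ is the Moore–Penrose pseudoinverse; $\sigma_{\max}(MB)$ and $\sigma_{\min}(MB)$ are the largest and smallest of the two singular values of $MB\in\mathbb{R}^{N\times2}$; the simplex-restricted conditioning is $\kappa_s=\sigma_{\max}(MB)/\sigma_{\min}(MB)$. The functional area is $\mathcal{A}(g)=\sqrt{\det\mathcal{G}}$, where $\mathcal{G}=(\langle D_i,D_j\rangle)_{i,j=1,2}$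 with the sampled inner product $\langle f,h\rangle=\sum_{i=1}^N f(\varphi_i)h(\varphi_i)$, $D_1=K_T-K_P$, $D_2=K_B-K_P$. *)

(* Defs.v *)
From mathcomp Require Import all_boot all_order all_algebra.
From mathcomp Require Import all_classical all_reals.
From mathcomp Require Import trigo.

Set Implicit Arguments.
Unset Strict Implicit.
Unset Printing Implicit Defensive.

Import Order.TTheory GRing.Theory Num.Theory.
Local Open Scope classical_set_scope.
Local Open Scope ring_scope.

(* Vectors are columns. The library's norm on matrices is the sup norm, hence
   a separate Euclidean norm. *)
Definition enorm (R : realType) (n : nat) (x : 'cV[R]_n) : R :=
  Num.sqrt (\sum_i x i 0 ^+ 2).

(* The singular values of an m x n matrix, in decreasing order: the n square
   roots of the eigenvalues of A^T A, counted with multiplicity. There are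
   always n of them, zeros included, even when m < n. *)
Definition is_singular_values (R : realType) (m n : nat) (A : 'M[R]_(m, n))
    (s : n.-tuple R) : Prop :=
  [/\ sorted (fun x y => y <= x) s,
      forall x, x \in s -> 0 <= x
    & char_poly (A^T *m A) = \prod_(x <- s) ('X - (x ^+ 2)%:P)].

Definition singular_values (R : realType) (m n : nat) (A : 'M[R]_(m, n)) :
    n.-tuple R :=
  xget [tuple of nseq n 0] [set s | is_singular_values A s].

Definition sigma_max (R : realType) (m n : nat) (A : 'M[R]_(m, n)) : R :=
  head 0 (singular_values A).

Definition sigma_min (R : realType) (m n : nat) (A : 'M[R]_(m, n)) : R :=
  last 0 (singular_values A).

Definition conditioning (R : realType) (m n : nat) (A : 'M[R]_(m, n)) : R :=
  sigma_max A / sigma_min A.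

Definition is_left_singular_vector (R : realType) (m n : nat)
    (A : 'M[R]_(m, n)) (s : R) (x : 'cV[R]_m) : Prop :=
  enorm x = 1 /\
  exists y : 'cV[R]_n,
    [/\ enorm y = 1, A *m y = s *: x & A^T *m x = s *: y].

(* The four Penrose equations. *)
Definition is_pseudoinverse (R : realType) (m n : nat) (A : 'M[R]_(m, n))
    (X : 'M[R]_(n, m)) : Prop :=
  [/\ A *m X *m A = A,
      X *m A *m X = X,
      (A *m X)^T = A *m X
    & (X *m A)^T = X *m A].

Definition pseudoinverse (R : realType) (m n : nat) (A : 'M[R]_(m, n)) :
    'M[R]_(n, m) :=
  xget 0 [set X | is_pseudoinverse A X].

Definition is_lsq_minimizer (R : realType) (m n : nat) (A : 'M[R]_(m, n))
    (b : 'cV[R]_m) (u : 'cV[R]_n) : Prop :=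
  forall v, enorm (A *m u - b) <= enorm (A *m v - b).

Definition is_min_norm_minimizer (R : realType) (m n : nat)
    (A : 'M[R]_(m, n)) (b : 'cV[R]_m) (u : 'cV[R]_n) : Prop :=
  is_lsq_minimizer A b u /\
  forall v, is_lsq_minimizer A b v -> enorm u <= enorm v.

Definition min_norm_minimizer (R : realType) (m n : nat)
    (A : 'M[R]_(m, n)) (b : 'cV[R]_m) : 'cV[R]_n :=
  xget 0 [set u | is_min_norm_minimizer A b u].

(* The profiles are only ever evaluated at sample points in [0, pi/2]; their
   values elsewhere are irrelevant. *)
Record geometry (R : realType) := Geometry {
  K_T : R -> R;
  K_B : R -> R;
  K_P : R -> R }.

Definition forward_map (R : realType) (N : nat) (phi : 'I_N -> R)
    (g : geometry R) : 'M[R]_(N, 3) :=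
  \matrix_(i < N, j < 3) tnth [tuple K_T g; K_B g; K_P g] j (phi i).

Definition sampled_dot (R : realType) (N : nat) (phi : 'I_N -> R)
    (f h : R -> R) : R :=
  \sum_i f (phi i) * h (phi i).

Definition contrast (R : realType) (g : geometry R) (j : 'I_2) : R -> R :=
  tnth [tuple K_T g \- K_P g; K_B g \- K_P g] j.

Definition functional_area (R : realType) (N : nat) (phi : 'I_N -> R)
    (g : geometry R) : R :=
  Num.sqrt (\det (\matrix_(i < 2, j < 2)
    sampled_dot phi (contrast g i) (contrast g j))).

Definition simplex (R : realType) : set 'cV[R]_3 :=
  [set w | (forall i, 0 <= w i 0) /\ \sum_i w i 0 = 1].

Definition is_recovered_load (R : realType) (N : nat) (M : 'M[R]_(N, 3))
    (k : 'cV[R]_N) (w : 'cV[R]_3) : Prop :=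
  simplex w /\
  forall v, simplex v -> enorm (M *m w - k) ^+ 2 <= enorm (M *m v - k) ^+ 2.

Definition unclipped (R : realType) (w : 'cV[R]_3) : Prop :=
  forall i, 0 < w i 0.

Definition is_sum_zero_orthonormal_basis (R : realType) (B : 'M[R]_(3, 2)) :
    Prop :=
  B^T *m B = 1%:M /\
  forall v : 'cV[R]_3, \sum_i v i 0 = 0 <-> exists u : 'cV[R]_2, v = B *m u.

(* The change of recovered load caused by dk, taken on the sum-zero tangent. *)
Definition recovery_error (R : realType) (N : nat) (M : 'M[R]_(N, 3))
    (B : 'M[R]_(3, 2)) (dk : 'cV[R]_N) : 'cV[R]_3 :=
  B *m min_norm_minimizer (M *m B) dk.

(* The size of the recovery error per unit of perturbation, in the worst
   direction: "the error" of a geometry, independently of the perturbation. *)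
Definition worst_error (R : realType) (N : nat) (M : 'M[R]_(N, 3))
    (B : 'M[R]_(3, 2)) : R :=
  sup [set enorm (recovery_error M B dk) | dk in [set dk | enorm dk <= 1]].

(* Main.v *)
Require Import Defs.
From mathcomp Require Import all_boot all_order all_algebra.
From mathcomp Require Import all_classical all_reals.
From mathcomp Require Import trigo.
From mathcomp Require Import ring lra.

Set Implicit Arguments.
Unset Strict Implicit.
Unset Printing Implicit Defensive.

Import Order.TTheory GRing.Theory Num.Theory.
Local Open Scope classical_set_scope.
Local Open Scope ring_scope.

(** Write A = M B. For any b, a vector u solves the least-squares problem
    min |A u - b| exactly when A^T (A u - b) = 0, and the shortest solution is
    A^+ b, where A^+ is built from a full-rank factorization of A
    (min_norm_minimizerE). Since B is an isometry, the recovery error has the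
    length of u = A^+ dk. The fit A u is an orthogonal projection of dk, so
    s |u| <= |A u| <= |dk| with s > 0 the least singular value; when dk = c x
    with x a left singular vector for s, the right singular vector y paired
    with x gives A ((c / s) y) = c x, so equality holds. This also computes the
    worst error as 1 / s.

    A has only two columns, so its singular values a >= b >= 0 are the numbers
    with a^2 + b^2 = tr (A^T A) and a^2 b^2 = det (A^T A) (sigma2_spec,
    sigma2_unique). Everything about them is read off these two equations: the
    inequality b |u| <= |A u|, the effect of scaling a geometry, and the area
    identity. For the latter, the contrasts D_1, D_2 are the profiles of the
    loads e_T - e_P and e_B - e_P, whose coordinates in the basis B form a
    matrix of determinant +- sqrt 3, because their own Gram matrix
    ((2, 1), (1, 2)) has determinant 3; hence the Gram determinant of the
    contrasts is 3 a^2 b^2 (functional_areaE).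

    The tangent error is the true change of the recovered load because an
    unclipped minimizer over the simplex satisfies the normal equations along
    all sum-zero directions (recovered_load_normal); subtracting these
    equations for the two observed profiles gives the tangent problem for dk.

    Finally, the ratio of the worst errors of g and g' is b' / b, and the ratio
    of their conditionings is that number times a / a', so the two agree exactly
    when a = a'. Doubling all the profiles keeps the conditioning and halves the
    error, so the conditioning alone does not determine it. *)

(** * Euclidean geometry of columns *)

Definition edot (R : realType) (n : nat) (x y : 'cV[R]_n) : R :=
  \sum_i x i 0 * y i 0.

Lemma edotE (R : realType) (n : nat) (x y : 'cV[R]_n) :
  edot x y = (x^T *m y) 0 0.
Proof. by rewrite mxE; apply: eq_bigr => i _; rewrite mxE. Qed.

Lemma edotC (R : realType) (n : nat) (x y : 'cV[R]_n) : edot x y = edot y x.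
Proof. by apply: eq_bigr => i _; rewrite mulrC. Qed.

Lemma edotDr (R : realType) (n : nat) (x y z : 'cV[R]_n) :
  edot x (y + z) = edot x y + edot x z.
Proof. by rewrite !edotE mulmxDr mxE. Qed.

Lemma edotDl (R : realType) (n : nat) (x y z : 'cV[R]_n) :
  edot (x + y) z = edot x z + edot y z.
Proof. by rewrite edotC edotDr !(edotC z). Qed.

Lemma edotZr (R : realType) (n : nat) (c : R) (x y : 'cV[R]_n) :
  edot x (c *: y) = c * edot x y.
Proof. by rewrite !edotE -scalemxAr mxE. Qed.

Lemma edotZl (R : realType) (n : nat) (c : R) (x y : 'cV[R]_n) :
  edot (c *: x) y = c * edot x y.
Proof. by rewrite edotC edotZr edotC. Qed.

Lemma edot0r (R : realType) (n : nat) (x : 'cV[R]_n) : edot x 0 = 0.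
Proof. by rewrite edotE mulmx0 mxE. Qed.

Lemma edot_adjoint (R : realType) (m n : nat) (A : 'M[R]_(m, n))
    (x : 'cV[R]_n) (y : 'cV[R]_m) :
  edot (A *m x) y = edot x (A^T *m y).
Proof. by rewrite !edotE trmx_mul mulmxA. Qed.

Lemma edot_ge0 (R : realType) (n : nat) (x : 'cV[R]_n) : 0 <= edot x x.
Proof. by apply: sumr_ge0 => i _; rewrite -expr2 sqr_ge0. Qed.

Lemma edot_eq0 (R : realType) (n : nat) (x : 'cV[R]_n) : edot x x = 0 -> x = 0.
Proof.
move=> /eqP; rewrite psumr_eq0 => [/allP h|i _]; last by rewrite -expr2 sqr_ge0.
apply/matrixP => i j; rewrite !mxE ord1; apply/eqP.
by have := h i (mem_index_enum i); rewrite -expr2 sqrf_eq0.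
Qed.

Lemma enormE (R : realType) (n : nat) (x : 'cV[R]_n) :
  enorm x = Num.sqrt (edot x x).
Proof. by []. Qed.

Lemma enorm_ge0 (R : realType) (n : nat) (x : 'cV[R]_n) : 0 <= enorm x.
Proof. exact: sqrtr_ge0. Qed.

Lemma enorm_sqr (R : realType) (n : nat) (x : 'cV[R]_n) :
  enorm x ^+ 2 = edot x x.
Proof. by rewrite enormE sqr_sqrtr ?edot_ge0. Qed.

Lemma enorm_le (R : realType) (m n : nat) (x : 'cV[R]_m) (y : 'cV[R]_n) :
  (enorm x <= enorm y) = (edot x x <= edot y y).
Proof. by rewrite !enormE ler_sqrt ?edot_ge0. Qed.

Lemma enormZ (R : realType) (n : nat) (c : R) (x : 'cV[R]_n) :
  enorm (c *: x) = `|c| * enorm x.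
Proof.
rewrite !enormE edotZl edotZr mulrA -expr2 sqrtrM ?sqr_ge0 //.
by rewrite sqrtr_sqr.
Qed.

Lemma pythagoras (R : realType) (n : nat) (x y : 'cV[R]_n) :
  edot x y = 0 -> edot (x + y) (x + y) = edot x x + edot y y.
Proof.
by move=> h; rewrite edotDl !edotDr (edotC y x) h addr0 add0r.
Qed.

Lemma enorm_isometry (R : realType) (m n : nat) (B : 'M[R]_(m, n))
    (u : 'cV[R]_n) :
  B^T *m B = 1%:M -> enorm (B *m u) = enorm u.
Proof. by move=> BB; rewrite !enormE edot_adjoint mulmxA BB mul1mx. Qed.

(** * Least squares and the pseudoinverse *)

(** A real matrix and its Gram matrix have the same kernel, so full column rank
    already makes the Gram matrix invertible. *)
Lemma gram_unit (R : realType) (m n : nat) (L : 'M[R]_(m, n)) :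
  row_full L -> L^T *m L \in unitmx.
Proof.
move=> /row_fullP [L' L'L]; rewrite -unitmx_tr -row_free_unit -kermx_eq0.
apply/eqP/row_matrixP => i; rewrite row0.
set v := row i _; have vG : v *m (L^T *m L)^T = 0.
  by rewrite -row_mul mulmx_ker row0.
have : L *m v^T = 0.
  apply: edot_eq0; rewrite edot_adjoint mulmxA.
  by rewrite -[L^T *m L]trmxK -trmx_mul vG trmx0 edot0r.
move=> /(congr1 (mulmx L')); rewrite mulmxA L'L mul1mx mulmx0.
by move=> /(congr1 trmx); rewrite trmxK trmx0.
Qed.

Lemma full_rank_factor_pseudoinverse (R : realType) (m r n : nat)
    (L : 'M[R]_(m, r)) (Q : 'M[R]_(r, n)) :
  row_full L -> row_free Q ->
  is_pseudoinverse (L *m Q)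
    (Q^T *m invmx (Q *m Q^T) *m (invmx (L^T *m L) *m L^T)).
Proof.
move=> fL fQ; pose A := L *m Q; have AE : A = L *m Q by [].
have uL : L^T *m L \in unitmx by exact: gram_unit.
have uQ : Q *m Q^T \in unitmx.
  rewrite -{1}[Q]trmxK gram_unit //.
  have /row_freeP [Q' QQ'] := fQ.
  by apply/row_fullP; exists Q'^T; rewrite -trmx_mul QQ' trmx1.
pose G := invmx (L^T *m L); pose H := invmx (Q *m Q^T).
have tG : G^T = G by rewrite /G trmx_inv trmx_mul trmxK.
have tH : H^T = H by rewrite /H trmx_inv trmx_mul trmxK.
have GL : G *m L^T *m L = 1%:M by rewrite -mulmxA mulVmx.
have QH : Q *m Q^T *m H = 1%:M by rewrite mulmxV.
pose X := Q^T *m H *m (G *m L^T).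
have AX : A *m X = L *m (G *m L^T).
  by rewrite AE /X !mulmxA -(mulmxA L) -(mulmxA L) QH mulmx1.
have XA : X *m A = Q^T *m H *m Q.
  by rewrite AE /X mulmxA -(mulmxA (Q^T *m H)) GL mulmx1.
rewrite -/A -/G -/H -/X; split.
- by rewrite AX AE mulmxA -(mulmxA L) GL mulmx1.
- by rewrite XA {1}/X mulmxA -(mulmxA (Q^T *m H) Q) (mulmxA Q) QH mulmx1.
- by rewrite AX !trmx_mul trmxK tG !mulmxA.
- by rewrite XA !trmx_mul trmxK tH !mulmxA.
Qed.

(** Every matrix, of whatever rank, factors through its row space, which covers
    the geometries whose least singular value vanishes. *)
Lemma pseudoinverse_exists (R : realType) (m n : nat) (A : 'M[R]_(m, n)) :
  exists X, is_pseudoinverse A X.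
Proof.
have := full_rank_factor_pseudoinverse (col_base_full A) (row_base_free A).
by rewrite mulmx_base; eexists; eassumption.
Qed.

Lemma pseudoinverseP (R : realType) (m n : nat) (A : 'M[R]_(m, n)) :
  is_pseudoinverse A (pseudoinverse A).
Proof. exact: (xgetPex 0 (pseudoinverse_exists A)). Qed.

(** Under the normal equation A u - b is orthogonal to the range of A, so this
    is Pythagoras for A v - b = A (v - u) + (A u - b). *)
Lemma lsq_split (R : realType) (m n : nat) (A : 'M[R]_(m, n))
    (b : 'cV[R]_m) (u v : 'cV[R]_n) :
  A^T *m (A *m u - b) = 0 ->
  edot (A *m v - b) (A *m v - b)
    = edot (A *m (v - u)) (A *m (v - u)) + edot (A *m u - b) (A *m u - b).
Proof.
move=> h; rewrite -pythagoras; last by rewrite edot_adjoint h edot0r.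
by rewrite mulmxBr addrA subrK.
Qed.

Lemma pseudoinverse_normal (R : realType) (m n : nat) (A : 'M[R]_(m, n))
    (X : 'M[R]_(n, m)) (b : 'cV[R]_m) :
  is_pseudoinverse A X -> A^T *m (A *m (X *m b) - b) = 0.
Proof.
move=> [AXA _ tAX _]; rewrite mulmxBr !mulmxA -(mulmxA A^T) -tAX -trmx_mul.
by rewrite AXA subrr.
Qed.

(** All least-squares minimizers share the same image A v. Among them X b is
    the shortest, because it lies in the range of the symmetric projection X A
    and is therefore orthogonal to its difference with any other minimizer. *)
Lemma min_norm_minimizerE (R : realType) (m n : nat) (A : 'M[R]_(m, n))
    (X : 'M[R]_(n, m)) (b : 'cV[R]_m) :
  is_pseudoinverse A X -> min_norm_minimizer A b = X *m b.
Proof.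
move=> hX; have normal := pseudoinverse_normal b hX.
have [AXA XAX _ tXA] := hX; set u := X *m b.
have u_min : is_lsq_minimizer A b u.
  by move=> v; rewrite enorm_le (lsq_split v normal) lerDr edot_ge0.
have split v : is_lsq_minimizer A b v ->
    edot v v = edot u u + edot (v - u) (v - u).
  move=> /(_ u); rewrite enorm_le (lsq_split v normal) gerDr => Avu.
  have {}Avu : A *m (v - u) = 0.
    by apply: edot_eq0; apply/eqP; rewrite eq_le Avu edot_ge0.
  rewrite -pythagoras ?subrKC //.
  have uE : X *m A *m u = u by rewrite /u mulmxA XAX.
  by rewrite -{1}uE edot_adjoint tXA -mulmxA Avu mulmx0 edot0r.
apply: xget_unique => [|v [v_min v_short]].
  split=> // v /split vE; rewrite enorm_le vE lerDl edot_ge0 //.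
have := v_short u u_min; rewrite enorm_le (split v v_min) gerDl => vu.
apply/eqP; rewrite -subr_eq0; apply/eqP/edot_eq0/eqP.
by rewrite eq_le vu edot_ge0.
Qed.

(** * Singular values of a two-column matrix *)

Lemma det_mx22 (R : comNzRingType) (S : 'M[R]_2) :
  \det S = S 0 0 * S 1 1 - S 0 1 * S 1 0.
Proof.
rewrite (expand_det_row _ 0) !big_ord_recl big_ord0 addr0 /cofactor !det_mx11 /=.
rewrite /row' /col' !mxE /= expr0 expr1 mul1r mulN1r mulrN.
by congr (S _ _ * S _ _ - S _ _ * S _ _); apply/val_inj.
Qed.

Lemma mxtrace22 (R : pzSemiRingType) (S : 'M[R]_2) : \tr S = S 0 0 + S 1 1.
Proof.
by rewrite /mxtrace !big_ord_recl big_ord0 addr0; congr (_ + S _ _); apply/val_inj.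
Qed.

Lemma char_poly22 (R : comNzRingType) (S : 'M[R]_2) :
  char_poly S = 'X^2 - (\tr S)%:P * 'X + (\det S)%:P.
Proof.
have entry i j : char_poly_mx S i j = 'X *+ (i == j) - (S i j)%:P.
  by rewrite !mxE.
rewrite /char_poly (det_mx22 (char_poly_mx S : 'M[{poly R}]_2)) !entry /=.
rewrite mxtrace22 det_mx22 polyCB polyCD !polyCM; ring.
Qed.

Lemma gram_sym (R : comPzRingType) (m n : nat) (A : 'M[R]_(m, n))
    (i j : 'I_n) :
  (A^T *m A) i j = (A^T *m A) j i.
Proof. by rewrite -[in LHS](trmxK A) -trmx_mul mxE trmxK. Qed.

Lemma edot_gram2 (R : realType) (m : nat) (A : 'M[R]_(m, 2)) (u : 'cV[R]_2) :
  let S := A^T *m A in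
  edot (A *m u) (A *m u)
    = S 0 0 * u 0 0 ^+ 2 + 2 * S 0 1 * u 0 0 * u 1 0 + S 1 1 * u 1 0 ^+ 2.
Proof.
move=> S; rewrite edot_adjoint mulmxA -/S.
have sym : S 1 0 = S 0 1 by exact: gram_sym.
clearbody S; rewrite /edot !big_ord_recl big_ord0 !mxE !big_ord_recl !big_ord0 /=.
have -> : lift ord0 ord0 = 1 :> 'I_2 by apply/val_inj.
rewrite sym; ring.
Qed.

Lemma psd_tr_det_ge0 (R : realFieldType) (p q r : R) :
  (forall x y, 0 <= p * x ^+ 2 + 2 * q * x * y + r * y ^+ 2) ->
  0 <= p + r /\ 0 <= p * r - q ^+ 2.
Proof.
move=> h; have p0 : 0 <= p by have := h 1 0; lra.
have r0 : 0 <= r by have := h 0 1; lra.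
split; first lra.
have [pr|pr] := eqVneq (p + r) 0.
  have := h 1 1; have := h 1 (-1); nra.
have {}pr : 0 < p + r by rewrite lt0r pr; lra.
(* the form at (q, -p) and at (r, -q) is the discriminant times p and r *)
have := h q (- p); have := h r (- q) => h1 h2.
rewrite -(pmulr_rge0 _ pr).
have -> : (p + r) * (p * r - q ^+ 2)
  = (p * q ^+ 2 + 2 * q * q * - p + r * (- p) ^+ 2)
    + (p * r ^+ 2 + 2 * q * r * - q + r * (- q) ^+ 2) by ring.
exact: addr_ge0.
Qed.

(** With a and b the eigenvalues of the matrix of the form, (p - b) + (r - b)
    = a - b >= 0 and (p - b) (r - b) = q^2, so the form minus b times the
    squared length is positive semidefinite. *)
Lemma quad_form_ge_min_eigenvalue (R : realFieldType) (p q r a b x y : R) :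
  p + r = a + b -> p * r - q ^+ 2 = a * b -> b <= a ->
  b * (x ^+ 2 + y ^+ 2) <= p * x ^+ 2 + 2 * q * x * y + r * y ^+ 2.
Proof.
move=> tr det ab; pose s := p - b; pose t := r - b.
have st : s * t = q ^+ 2.
  have -> : s * t = p * r - b * (p + r) + b ^+ 2 by rewrite /s /t; ring.
  have -> : p * r = a * b + q ^+ 2 by rewrite -det; ring.
  by rewrite tr; ring.
have st0 : 0 <= s + t by rewrite /s /t; lra.
rewrite -subr_ge0.
have -> : p * x ^+ 2 + 2 * q * x * y + r * y ^+ 2 - b * (x ^+ 2 + y ^+ 2)
  = s * x ^+ 2 + 2 * q * x * y + t * y ^+ 2 by rewrite /s /t; ring.
move: s t st st0 => s t st st0 {tr det}.
have stq : 0 <= s * t by rewrite st sqr_ge0.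
have [s0 t0] : 0 <= s /\ 0 <= t by split; nra.
have [z|z] := eqVneq (s + t) 0.
  have s00 : s = 0 by lra.
  have q0 : q = 0 by apply/eqP; rewrite -sqrf_eq0 -st s00 mul0r.
  by rewrite q0 s00 mulr0 !mul0r !add0r mulr_ge0 ?sqr_ge0.
have {}z : 0 < s + t by rewrite lt0r z.
rewrite -(pmulr_rge0 _ z).
have -> : (s + t) * (s * x ^+ 2 + 2 * q * x * y + t * y ^+ 2)
  = (s * x + q * y) ^+ 2 + (q * x + t * y) ^+ 2
    + (s * t - q ^+ 2) * (x ^+ 2 + y ^+ 2) by ring.
by rewrite st subrr mul0r addr0 addr_ge0 ?sqr_ge0.
Qed.

(** The eigenvalues (t + d) / 2 and (t - d) / 2 of the Gram matrix, with t its
    trace and d the root of the discriminant, are nonnegative since the Gram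
    matrix is positive semidefinite; their square roots are the singular
    values. *)
Lemma singular_values2_exist (R : realType) (m : nat) (A : 'M[R]_(m, 2)) :
  exists s, is_singular_values A s.
Proof.
pose S := A^T *m A; pose p := S 0 0; pose q := S 0 1; pose r := S 1 1.
have S10 : S 1 0 = q by exact: gram_sym.
have [tr0 det0] : 0 <= p + r /\ 0 <= p * r - q ^+ 2.
  apply: psd_tr_det_ge0 => x y; pose u : 'cV[R]_2 := \col_i (if i == 0 then x else y).
  have [u0 u1] : u 0 0 = x /\ u 1 0 = y by rewrite !mxE.
  by have := edot_ge0 (A *m u); rewrite edot_gram2 u0 u1.
pose d := Num.sqrt ((p - r) ^+ 2 + 4 * q ^+ 2).
have d2 : d ^+ 2 = (p + r) ^+ 2 - 4 * (p * r - q ^+ 2).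
  rewrite sqr_sqrtr; first by ring.
  by rewrite addr_ge0 ?sqr_ge0 // mulr_ge0 ?sqr_ge0 ?ler0n.
have d0 : 0 <= d by rewrite sqrtr_ge0.
have dt : d <= p + r by rewrite -(ler_pXn2r (n := 2)) ?nnegrE // d2; lra.
pose a := (p + r + d) / 2; pose b := (p + r - d) / 2.
have b0 : 0 <= b by rewrite /b; lra.
have ab : b <= a by rewrite /a /b; lra.
exists [tuple Num.sqrt a; Num.sqrt b]; split.
- by rewrite /= andbT ler_sqrt // (le_trans b0).
- by move=> x; rewrite !inE => /orP [] /eqP ->; rewrite sqrtr_ge0.
rewrite char_poly22 -/S mxtrace22 det_mx22 S10 -/p -/q -/r.
rewrite big_cons big_cons big_nil mulr1 !sqr_sqrtr // ?(le_trans b0) //.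
have -> : p + r = a + b by rewrite /a /b; field.
have -> : p * r - q * q = a * b.
  have -> : a * b = ((p + r) ^+ 2 - d ^+ 2) / 4 by rewrite /a /b; field.
  by rewrite d2; field.
clearbody a b; rewrite (polyCD a b) (polyCM a b); ring.
Qed.

(** Comparison of the characteristic polynomial X^2 - tr X + det of the Gram
    matrix with its factorization, at 0 and at 1. *)
Lemma sigma2_spec (R : realType) (m : nat) (A : 'M[R]_(m, 2)) :
  [/\ 0 <= sigma_min A <= sigma_max A,
      sigma_max A ^+ 2 + sigma_min A ^+ 2 = \tr (A^T *m A)
    & sigma_max A ^+ 2 * sigma_min A ^+ 2 = \det (A^T *m A)].
Proof.
have : is_singular_values A (singular_values A).
  exact: (xgetPex _ (singular_values2_exist A)).
rewrite /sigma_min /sigma_max.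
case: (singular_values A) => [[|a [|b [|? ?]]] //= sz] [] /=.
rewrite andbT => ab pos; rewrite char_poly22 big_cons big_cons big_nil mulr1 => h.
have b0 : 0 <= b by apply: pos; rewrite !inE eqxx orbT.
split; first by rewrite b0.
- move/(congr1 (fun f : {poly R} => f.[1] - f.[0])): h; rewrite !hornerE /=; lra.
- move/(congr1 (fun f : {poly R} => f.[0])): h; rewrite !hornerE /=; lra.
Qed.

(** The sum of squares and the product of two ordered nonnegative numbers
    determine (a + b)^2 and (a - b)^2, hence a and b. *)
Lemma sigma2_unique (R : realType) (m : nat) (A : 'M[R]_(m, 2)) (a b : R) :
  0 <= b <= a -> a ^+ 2 + b ^+ 2 = \tr (A^T *m A) ->
  a ^+ 2 * b ^+ 2 = \det (A^T *m A) -> sigma_max A = a /\ sigma_min A = b.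
Proof.
have [/andP[s0 sS] <- <-] := sigma2_spec A; move=> /andP[b0 ba].
move: (sigma_max A) (sigma_min A) s0 sS => c d d0 dc sum prod.
have eq_sqr (x y : R) : 0 <= x -> 0 <= y -> x ^+ 2 = y ^+ 2 -> x = y.
  by move=> x0 y0 /eqP; rewrite eqrXn2 // => /eqP.
have {}prod : a * b = c * d.
  by apply: eq_sqr; rewrite ?mulr_ge0 ?exprMn // (le_trans _ ba, le_trans _ dc).
have add : c + d = a + b.
  apply: eq_sqr; [lra|lra|].
  have -> : (c + d) ^+ 2 = c ^+ 2 + d ^+ 2 + 2 * (c * d) by ring.
  by rewrite -sum -prod; ring.
have sub : c - d = a - b.
  apply: eq_sqr; [lra|lra|].
  have -> : (c - d) ^+ 2 = c ^+ 2 + d ^+ 2 - 2 * (c * d) by ring.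
  by rewrite -sum -prod; ring.
by split; lra.
Qed.

Lemma sigma2_scale (R : realType) (m : nat) (A : 'M[R]_(m, 2)) (c : R) :
  0 <= c ->
  sigma_max (c *: A) = c * sigma_max A /\ sigma_min (c *: A) = c * sigma_min A.
Proof.
move=> c0; have [/andP[s0 sS] tr det] := sigma2_spec A.
have GE : (c *: A)^T *m (c *: A) = c ^+ 2 *: (A^T *m A).
  by rewrite [(c *: A)^T]linearZ /= -scalemxAl -scalemxAr scalerA expr2.
apply: sigma2_unique; rewrite ?GE.
- by rewrite mulr_ge0 //= ler_wpM2l.
- by rewrite mxtraceZ -tr; ring.
- by rewrite detZ -det; ring.
Qed.

Lemma sigma_min_enorm (R : realType) (m : nat) (A : 'M[R]_(m, 2))
    (u : 'cV[R]_2) :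
  sigma_min A * enorm u <= enorm (A *m u).
Proof.
have [/andP[s0 sS] tr det] := sigma2_spec A.
rewrite -(ler_pXn2r (n := 2)) ?nnegrE ?mulr_ge0 ?enorm_ge0 // exprMn !enorm_sqr.
rewrite edot_gram2 /edot !big_ord_recl big_ord0 addr0 -!expr2.
have -> : lift ord0 ord0 = 1 :> 'I_2 by apply/val_inj.
apply: (@quad_form_ge_min_eigenvalue _ _ _ _ (sigma_max A ^+ 2)).
- by rewrite tr mxtrace22.
- by rewrite det det_mx22 (gram_sym A 1 0).
- by rewrite ler_pXn2r ?nnegrE // (le_trans s0).
Qed.

(** A positive least singular value makes A injective, so the normal equation
    has one solution only. *)
Lemma min_norm_minimizer_normal (R : realType) (m : nat) (A : 'M[R]_(m, 2))
    (b : 'cV[R]_m) (u : 'cV[R]_2) :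
  0 < sigma_min A -> A^T *m (A *m u - b) = 0 -> min_norm_minimizer A b = u.
Proof.
move=> s0 hu; have hX := pseudoinverseP A.
rewrite (min_norm_minimizerE b hX).
have hv := pseudoinverse_normal b hX; set v := _ *m b in hv *.
have Avu : A *m (v - u) = 0.
  apply: edot_eq0; rewrite edot_adjoint.
  have -> : A *m (v - u) = (A *m v - b) - (A *m u - b).
    by rewrite mulmxBr opprB addrA subrK.
  by rewrite mulmxBr hu hv subrr edot0r.
have := sigma_min_enorm A (v - u).
rewrite Avu [enorm 0]enormE edot0r sqrtr0 pmulr_rle0 // => vu0.
have {}vu0 : enorm (v - u) = 0 by apply/eqP; rewrite eq_le vu0 enorm_ge0.
by apply/eqP; rewrite -subr_eq0; apply/eqP/edot_eq0; rewrite -enorm_sqr vu0 expr0n.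
Qed.
(** * First-order condition for unclipped loads *)

Lemma sum_edot1 (R : realType) (n : nat) (v : 'cV[R]_n) :
  \sum_i v i 0 = edot (const_mx 1) v.
Proof. by apply: eq_bigr => i _; rewrite mxE mul1r. Qed.

Lemma sum_col_step (R : realType) (n : nat) (w v : 'cV[R]_n) (s : R) :
  \sum_i (w + s *: v) i 0 = \sum_i w i 0 + s * \sum_i v i 0.
Proof. by rewrite !sum_edot1 edotDr edotZr. Qed.

Lemma unclipped_step (R : realType) (w v : 'cV[R]_3) :
  unclipped w -> exists2 t : R, 0 < t &
    forall s, `|s| <= t -> forall i, 0 <= (w + s *: v) i 0.
Proof.
move=> w0; pose T := \sum_i (1 + `|v i 0|) / w i 0.
(* 1 / T lies below each of the ratios w_i / (1 + |v_i|) *)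
have term_gt0 i : 0 < (1 + `|v i 0|) / w i 0 by rewrite divr_gt0 ?ltr_pwDl.
have term_le i : (1 + `|v i 0|) / w i 0 <= T.
  rewrite /T (bigD1 i) //= lerDl; apply: sumr_ge0 => j _; exact: ltW.
have T0 : 0 < T := lt_le_trans (term_gt0 0) (term_le 0).
exists T^-1; rewrite ?invr_gt0 // => s sT i; rewrite !mxE.
suff : `|s * v i 0| <= w i 0 by rewrite ler_norml => /andP[]; lra.
rewrite normrM; apply: (le_trans (ler_wpM2r (normr_ge0 _) sT)).
rewrite mulrC ler_pdivrMr // mulrC -ler_pdivrMr //.
apply: le_trans (term_le i); rewrite ler_pM2r ?invr_gt0 //; lra.
Qed.

Lemma first_order_eq0 (R : realFieldType) (d q t : R) :
  0 < t -> 0 <= q ->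
  (forall s, `|s| <= t -> 0 <= 2 * s * d + s ^+ 2 * q) -> d = 0.
Proof.
move=> t0 q0 h; pose D := `|d| + t * q + 1.
have D0 : 0 < D by rewrite /D ltr_wpDl // addr_ge0 // mulr_ge0 // ltW.
(* small enough for e |d| <= t and e q <= 1, so that s = - e d is an
   admissible step whose linear term dominates *)
pose e := t / D; have e0 : 0 < e by rewrite divr_gt0.
have ed : e * `|d| <= t.
  rewrite /e mulrAC ler_pdivrMr // ler_pM2l // /D -addrA lerDl.
  by rewrite addr_ge0 // mulr_ge0 // ltW.
have eq : e * q <= 1.
  by rewrite /e mulrAC ler_pdivrMr // mul1r /D addrAC lerDr addr_ge0.
have := h (- (e * d)); rewrite normrN normrM gtr0_norm // => /(_ ed) hs.
have : e * d ^+ 2 <= 0.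
  have := ler_wpM2r (mulr_ge0 (ltW e0) (sqr_ge0 d)) eq; nra.
rewrite pmulr_rle0 // => d2; apply/eqP.
by rewrite -sqrf_eq0 eq_le d2 sqr_ge0.
Qed.

(** An unclipped load can be moved both ways along every sum-zero direction
    without leaving the simplex, so the residual is orthogonal to all of the
    tangent profiles M v. *)
Lemma recovered_load_normal (R : realType) (N : nat) (M : 'M[R]_(N, 3))
    (k : 'cV[R]_N) (w v : 'cV[R]_3) :
  is_recovered_load M k w -> unclipped w -> \sum_i v i 0 = 0 ->
  edot (M *m w - k) (M *m v) = 0.
Proof.
move=> [[_ w1] w_min] w0 v0; have [t t0 step] := unclipped_step v w0.
apply: (first_order_eq0 t0 (edot_ge0 (M *m v))) => s /step ws.
have /w_min : simplex (w + s *: v).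
  by split=> //; rewrite sum_col_step v0 mulr0 addr0.
rewrite !enorm_sqr mulmxDr -scalemxAr addrAC.
move: (M *m w - k) (M *m v) => r z.
rewrite (edotDl r) !edotDr !edotZl !edotZr (edotC z r) => le.
rewrite -(lerD2l (edot r r)) addr0 (le_trans le) // le_eqVlt; apply/orP; left.
by apply/eqP; ring.
Qed.

(** * The sum-zero basis and the functional area *)

Lemma sum_zero_basis_proj (R : realType) (B : 'M[R]_(3, 2)) (v : 'cV[R]_3) :
  is_sum_zero_orthonormal_basis B -> \sum_i v i 0 = 0 ->
  v = B *m (B^T *m v).
Proof.
by move=> [BB span] /span [u ->]; rewrite (mulmxA B^T) BB mul1mx.
Qed.

(** The columns of this matrix are e_T - e_P and e_B - e_P, the sum-zero loads
    whose profiles are the contrasts D_1 and D_2. *)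
Definition contrast_loads (R : realType) : 'M[R]_(3, 2) :=
  \matrix_(i, j) ((i == lift ord_max j)%:R - (i == ord_max)%:R).

Lemma sampled_contrast_loads (R : realType) (N : nat) (phi : 'I_N -> R)
    (g : geometry R) :
  forward_map phi g *m contrast_loads R
    = \matrix_(i, j) contrast g j (phi i).
Proof.
apply/matrixP => i j; rewrite !mxE !big_ord_recl big_ord0 !mxE /contrast.
by case: j => [[|[|//]] lt]; rewrite !(tnth_nth (K_T g)) /=; ring.
Qed.

Lemma contrast_loads_sum_zero (R : realType) (j : 'I_2) :
  \sum_i col j (contrast_loads R) i 0 = 0.
Proof.
rewrite !big_ord_recl big_ord0 !mxE.
by case: j => [[|[|//]] lt] /=; ring.
Qed.

Lemma det_gram_contrast_loads (R : realType) :
  \det ((contrast_loads R)^T *m contrast_loads R) = 3.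
Proof.
rewrite det_mx22 !mxE !big_ord_recl !big_ord0 !mxE /=; ring.
Qed.

Lemma gram_mul (R : comPzRingType) (m n p : nat) (A : 'M[R]_(m, n))
    (C : 'M[R]_(n, p)) :
  (A *m C)^T *m (A *m C) = C^T *m (A^T *m A) *m C.
Proof. by rewrite trmx_mul !mulmxA. Qed.

(** In the orthonormal basis B the contrast loads have a coordinate matrix C
    with det C ^ 2 = 3, the squared area of the parallelogram they span; this
    is the only place where the factor sqrt 3 comes from. The Gram matrix of
    the contrasts is C^T ((M B)^T (M B)) C. *)
Lemma functional_areaE (R : realType) (N : nat) (phi : 'I_N -> R)
    (B : 'M[R]_(3, 2)) (g : geometry R) :
  is_sum_zero_orthonormal_basis B ->
  let A := forward_map phi g *m B in
  functional_area phi g = Num.sqrt 3 * (sigma_min A * sigma_max A).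
Proof.
move=> hB A; have [BB _] := hB.
pose P := contrast_loads R; pose C := B^T *m P.
have PE : P = B *m C.
  apply/matrixP => i j; rewrite /C mulmxA.
  have /matrixP /(_ i 0) :=
    sum_zero_basis_proj hB (contrast_loads_sum_zero R j).
  by rewrite colE !mulmxA -!colE !mxE.
clearbody C.
have detC : \det C ^+ 2 = 3.
  have <- : \det (C^T *m C) = \det C ^+ 2 by rewrite det_mulmx det_tr expr2.
  by rewrite -(det_gram_contrast_loads R) -/P PE gram_mul BB mulmx1.
have [/andP[s0 sS] _ det] := sigma2_spec A.
rewrite /functional_area.
set G := \matrix_(_, _) _; have -> : G = C^T *m (A^T *m A) *m C.
  rewrite -gram_mul /A -mulmxA -PE sampled_contrast_loads.
  apply/matrixP => i j; rewrite !mxE /sampled_dot.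
  by apply: eq_bigr => k _; rewrite !mxE.
have -> : \det (C^T *m (A^T *m A) *m C)
    = 3 * (sigma_min A * sigma_max A) ^+ 2.
  by rewrite !det_mulmx det_tr -det -detC; ring.
rewrite sqrtrM // sqrtr_sqr ger0_norm // mulr_ge0 //.
exact: le_trans sS.
Qed.

(** * The recovery error *)

Lemma recovery_error_enorm_le (R : realType) (N : nat) (M : 'M[R]_(N, 3))
    (B : 'M[R]_(3, 2)) (dk : 'cV[R]_N) :
  B^T *m B = 1%:M -> 0 < sigma_min (M *m B) ->
  enorm (recovery_error M B dk) <= enorm dk / sigma_min (M *m B).
Proof.
move=> BB s0; set A := M *m B in s0 *.
have hX := pseudoinverseP A.
rewrite /recovery_error enorm_isometry // (min_norm_minimizerE _ hX).
have normal := pseudoinverse_normal dk hX.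
rewrite ler_pdivlMr // mulrC; apply: (le_trans (sigma_min_enorm _ _)).
(* comparing with the zero load splits the squared length of the profile into
   those of its fit and of its residual *)
rewrite enorm_le -[X in _ <= X]/(edot dk dk).
have := lsq_split 0 normal; rewrite mulmx0 !sub0r !mulmxN.
rewrite -scaleN1r -[- (A *m _)]scaleN1r !edotZl !edotZr !mulrA mulrNN !mul1r => ->.
by rewrite lerDl edot_ge0.
Qed.

(** If y is the right singular vector paired with x and s the least singular
    value, then (c / s) y fits the profile c x exactly, and the least-squares
    solution is unique. *)
Lemma recovery_error_left_singular (R : realType) (N : nat)
    (M : 'M[R]_(N, 3)) (B : 'M[R]_(3, 2)) (x : 'cV[R]_N) (c : R) :
  B^T *m B = 1%:M -> 0 < sigma_min (M *m B) ->
  is_left_singular_vector (M *m B) (sigma_min (M *m B)) x ->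
  enorm (recovery_error M B (c *: x)) = enorm (c *: x) / sigma_min (M *m B).
Proof.
move=> BB s0; set A := M *m B in s0 *; move=> [x1 [y [y1 Ay _]]].
rewrite /recovery_error enorm_isometry //.
rewrite (@min_norm_minimizer_normal _ _ _ _ ((c / sigma_min A) *: y)) //.
  by rewrite !enormZ x1 y1 normrM normfV (gtr0_norm s0) !mulr1.
by rewrite -scalemxAr Ay scalerA divfK ?gt_eqF // subrr mulmx0.
Qed.

(** If y is a unit eigenvector of A^T A for the eigenvalue s^2, then A y / s is
    a left singular vector. *)
Lemma least_left_singular_vector_exists (R : realType) (m : nat)
    (A : 'M[R]_(m, 2)) :
  0 < sigma_min A -> exists x, is_left_singular_vector A (sigma_min A) x.
Proof.
move=> s0; have [_ tr det] := sigma2_spec A; set s := sigma_min A in s0 tr det *.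
have : eigenvalue (A^T *m A) (s ^+ 2).
  have value e : (char_poly (A^T *m A)).[e]
      = e ^+ 2 - \tr (A^T *m A) * e + \det (A^T *m A).
    by rewrite char_poly22 !hornerE.
  by rewrite eigenvalue_root_char /root value -tr -det; apply/eqP; ring.
move=> /eigenvalueP [v vE v0]; pose z := v^T.
have zE : A^T *m A *m z = s ^+ 2 *: z.
  by have := congr1 trmx vE; rewrite !trmx_mul trmxK linearZ.
have z0 : 0 < enorm z.
  rewrite lt0r enorm_ge0 andbT; apply: contra v0 => /eqP z0.
  by rewrite -[v]trmxK -/z (edot_eq0 (x := z)) ?trmx0 // -enorm_sqr z0 expr0n.
pose y := (enorm z)^-1 *: z.
have y1 : enorm y = 1.
  by rewrite enormZ gtr0_norm ?invr_gt0 // mulVf // gt_eqF.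
have yE : A^T *m A *m y = s ^+ 2 *: y.
  by rewrite -scalemxAr zE !scalerA mulrC.
exists (s^-1 *: (A *m y)); split; last first.
  exists y; split=> //; first by rewrite scalerA divff ?gt_eqF // scale1r.
  by rewrite -scalemxAr mulmxA yE scalerA expr2 mulKf ?gt_eqF.
rewrite enormZ gtr0_norm ?invr_gt0 // enormE edot_adjoint mulmxA yE.
by rewrite edotZr -enorm_sqr y1 expr1n mulr1 sqrtr_sqr gtr0_norm // mulVf ?gt_eqF.
Qed.

Lemma worst_errorE (R : realType) (N : nat) (M : 'M[R]_(N, 3))
    (B : 'M[R]_(3, 2)) :
  B^T *m B = 1%:M -> 0 < sigma_min (M *m B) ->
  worst_error M B = (sigma_min (M *m B))^-1.
Proof.
move=> BB s0; rewrite /worst_error; set E := [set _ | _ in _].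
have ubE : ubound E (sigma_min (M *m B))^-1.
  move=> _ [dk /= dk1 <-].
  apply: (le_trans (recovery_error_enorm_le dk BB s0)).
  by rewrite ler_pdivrMr // mulVf // gt_eqF.
have [x x_sing] := least_left_singular_vector_exists s0.
have [x1 _] := x_sing.
have Es : E (sigma_min (M *m B))^-1.
  exists x; first by rewrite /= x1.
  by rewrite -[x]scale1r recovery_error_left_singular // scale1r x1 mul1r.
apply/eqP; rewrite eq_le; apply/andP; split.
  by apply: ge_sup => //; exists (sigma_min (M *m B))^-1.
by apply: ub_le_sup => //; exists (sigma_min (M *m B))^-1.
Qed.

(** Both recovered loads satisfy the normal equations on the sum-zero tangent.
    Their difference is B u for some u, and subtracting the two equations leaves
    the normal equation of the tangent problem for dk, whose solution is unique
    when the least singular value is positive. *)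
Lemma recovered_load_change (R : realType) (N : nat) (M : 'M[R]_(N, 3))
    (B : 'M[R]_(3, 2)) (k dk : 'cV[R]_N) (w w' : 'cV[R]_3) :
  is_sum_zero_orthonormal_basis B -> 0 < sigma_min (M *m B) ->
  is_recovered_load M k w -> unclipped w ->
  is_recovered_load M (k + dk) w' -> unclipped w' ->
  w' - w = recovery_error M B dk.
Proof.
move=> hB s0 hw w0 hw' w0'; have [BB span] := hB.
have sum0 : \sum_i (w' - w) i 0 = 0.
  have [[[_ w1] _] [[_ w1'] _]] := (hw, hw').
  by rewrite -scaleN1r sum_col_step w1 w1' mulN1r subrr.
have [u uE] := (span _).1 sum0.
rewrite uE /recovery_error (min_norm_minimizer_normal (u := u)) //.
have normal v : edot (M *m (w' - w) - dk) (M *m (B *m v)) = 0.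
  have Bv0 : \sum_i (B *m v) i 0 = 0 by apply/span; exists v.
  have h := recovered_load_normal hw w0 Bv0.
  have h' := recovered_load_normal hw' w0' Bv0.
  have -> : M *m (w' - w) - dk
      = (M *m w' - (k + dk)) + (-1) *: (M *m w - k).
    rewrite mulmxBr; move: (M *m w') (M *m w) => p q.
    by apply/matrixP => i j; rewrite !mxE; ring.
  by rewrite edotDl edotZl h h' mulr0 addr0.
apply: edot_eq0; rewrite -edot_adjoint edotC -(mulmxA M B u) -uE -(mulmxA M).
exact: normal.
Qed.

(** * Scaling a geometry *)

Definition scale_geometry (R : realType) (c : R) (g : geometry R) :
    geometry R :=
  Geometry (c \*o K_T g) (c \*o K_B g) (c \*o K_P g).

Lemma forward_map_scale (R : realType) (N : nat) (phi : 'I_N -> R) (c : R)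
    (g : geometry R) :
  forward_map phi (scale_geometry c g) = c *: forward_map phi g.
Proof.
apply/matrixP => i j; rewrite !mxE !(tnth_nth (K_T g)).
by case: j => [[|[|[|//]]] lt].
Qed.

Lemma double_neq (R : realFieldType) (x : R) : 0 < x -> 2 * x <> x.
Proof. by move=> x0 eqx; lra. Qed.

Theorem proposition3 (R : realType) (N : nat) (phi : 'I_N -> R)
    (phi_range : forall i, 0 <= phi i <= pi / 2)
    (B : 'M[R]_(3, 2)) (B_basis : is_sum_zero_orthonormal_basis B)
    (g : geometry R) :
  let M h := forward_map phi h in
  let smax h := sigma_max (M h *m B) in
  let smin h := sigma_min (M h *m B) in
  let kappa h := conditioning (M h *m B) in
  let area h := functional_area phi h in
  let E h := worst_error (M h) B in
  (* the tangent error is the actual change of the recovered load *)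
  (forall (k_obs dk : 'cV[R]_N) (w w' : 'cV[R]_3),
     0 < smin g ->
     is_recovered_load (M g) k_obs w -> unclipped w ->
     is_recovered_load (M g) (k_obs + dk) w' -> unclipped w' ->
     w' - w = recovery_error (M g) B dk)
  /\
  (* error formula and bound *)
  (forall dk : 'cV[R]_N,
     enorm (recovery_error (M g) B dk)
       = enorm (B *m pseudoinverse (M g *m B) *m dk)
     /\ (0 < smin g ->
         enorm (recovery_error (M g) B dk) <= enorm dk / smin g))
  /\
  (* attainment along least left singular vectors *)
  (0 < smin g ->
     (exists x, is_left_singular_vector (M g *m B) (smin g) x) /\
     (forall (x : 'cV[R]_N) (c : R),
        is_left_singular_vector (M g *m B) (smin g) x ->
        enorm (recovery_error (M g) B (c *: x)) = enorm (c *: x) / smin g))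
  /\
  (* identities, and the equivalent forms of the bound *)
  smin g * smax g = area g / Num.sqrt 3
  /\
  (0 < smin g ->
     kappa g = Num.sqrt 3 * smax g ^+ 2 / area g /\
     forall dk : 'cV[R]_N,
       [/\ enorm (recovery_error (M g) B dk) <= enorm dk / smin g,
           enorm dk / smin g = Num.sqrt 3 * smax g / area g * enorm dk
         & Num.sqrt 3 * smax g / area g * enorm dk
             = kappa g / smax g * enorm dk])
  /\
  (* the stability margin is smin *)
  (0 < smin g -> E g = (smin g)^-1)
  /\
  (* the error scales with kappa exactly at fixed smax *)
  (forall g' : geometry R, 0 < smin g -> 0 < smin g' ->
     (E g / E g' = kappa g / kappa g' <-> smax g = smax g'))
  /\
  (* kappa alone does not determine the error *)
  (0 < smin g ->
     exists g' : geometry R,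
       [/\ 0 < smin g', kappa g' = kappa g, smax g' <> smax g & E g' <> E g]).
Proof.
move=> M smax smin kappa area E; have [BB _] := B_basis.
have sqrt3 : 0 < Num.sqrt 3 :> R by rewrite sqrtr_gt0.
have smin_le h : smin h <= smax h by have [/andP[]] := sigma2_spec (M h *m B).
have areaE : area g = Num.sqrt 3 * (smin g * smax g).
  exact: functional_areaE.
have kappaE h : kappa h = smax h / smin h by [].
have EE h : 0 < smin h -> E h = (smin h)^-1 by exact: worst_errorE.
have bound dk : 0 < smin g ->
    enorm (recovery_error (M g) B dk) <= enorm dk / smin g.
  exact: recovery_error_enorm_le.
split.
  by move=> k dk w w' s0; exact: recovered_load_change.
split.
  move=> dk; split; last exact: bound.
  by rewrite /recovery_error (min_norm_minimizerE _ (pseudoinverseP _)) mulmxA.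
split.
  move=> s0; split; first exact: least_left_singular_vector_exists.
  by move=> x c; exact: recovery_error_left_singular.
split; first by rewrite areaE mulrAC divff ?mul1r ?gt_eqF.
split.
  move=> s0; have S0 : 0 < smax g := lt_le_trans s0 (smin_le g).
  split.
    rewrite areaE kappaE; move: (smin g) (smax g) (Num.sqrt 3) s0 S0 sqrt3.
    by move=> s S r s0 S0 r0; field; rewrite !gt_eqF.
  move=> dk; split; first exact: bound.
    rewrite areaE; move: (smin g) (smax g) (Num.sqrt 3) s0 S0 sqrt3.
    by move=> s S r s0 S0 r0; field; rewrite !gt_eqF.
  rewrite areaE kappaE; move: (smin g) (smax g) (Num.sqrt 3) s0 S0 sqrt3.
  by move=> s S r s0 S0 r0; field; rewrite !gt_eqF.
split; first exact: EE.
split.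
  move=> g' s0 s0'; rewrite (EE g s0) (EE g' s0') (kappaE g) (kappaE g').
  have := lt_le_trans s0' (smin_le g'); have := lt_le_trans s0 (smin_le g).
  move: (smin g) (smin g') (smax g) (smax g') s0 s0' => s s' S S' s0 s0' S0 S0'.
  have [sn sn' Sn Sn'] : [/\ s != 0, s' != 0, S != 0 & S' != 0].
    by rewrite !gt_eqF.
  have -> : S / s / (S' / s') = (s^-1 / s'^-1) * (S / S').
    by field; rewrite sn sn' Sn'.
  split=> [|->]; last by rewrite divff // mulr1.
  rewrite -[LHS]mulr1 => /mulfI h; apply/esym/divr1_eq.
  rewrite -invf_div -h ?invr1 //.
  by rewrite mulf_neq0 ?invr_eq0.
move=> s0; exists (scale_geometry 2 g).
have MBE : M (scale_geometry 2 g) *m B = 2 *: (M g *m B).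
  by rewrite /M forward_map_scale scalemxAl.
have [SE sE] := sigma2_scale (M g *m B) (ler0n R 2).
have {}SE : smax (scale_geometry 2 g) = 2 * smax g by rewrite /smax MBE.
have {}sE : smin (scale_geometry 2 g) = 2 * smin g by rewrite /smin MBE.
have S0 : 0 < smax g := lt_le_trans s0 (smin_le g).
have s0' : 0 < smin (scale_geometry 2 g) by rewrite sE mulr_gt0.
split.
- exact: s0'.
- rewrite (kappaE (scale_geometry 2 g)) (kappaE g) SE sE; move: (smin g) (smax g) s0 => s S s0.
  by field; rewrite gt_eqF.
- by rewrite SE; exact: double_neq.
- rewrite (EE _ s0') (EE g s0) => /invr_inj; rewrite sE; exact: double_neq.
Qed.
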